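(* Let $X$ and $Y$ be real locally convex topological vector spaces and let $F\colon X\rightrightarrows Y$ be a quasi-nearly convex set-valued mapping. The following assertions hold: (a) If $\operatorname{gph}(F)$ is quasi-regular, then $$\operatorname{qri}(\operatorname{gph}(F))\subset\{(x,y)\in X\times Y\mid x\in\operatorname{qri}(\operatorname{dom}(F)),\ y\in\operatorname{qri}(F(x))\}.$$ (b) If $F(x)$ is quasi-nearly convex and $\operatorname{qi}(F(x))\neq\emptyset$ for every $x\in\operatorname{dom}(F)$, then $$\operatorname{qri}(\operatorname{gph}(F))\supset\{(x,y)\in X\times Y\mid x\in\operatorname{qri}(\operatorname{dom}(F)),\ y\in\operatorname{qri}(F(x))\}.$$ Consequently, if $\operatorname{gph}(F)$ is quasi-regular and $\operatorname{qi}(F(x))\neq\emptyset$ for every $x\in\operatorname{dom}(F)$, then $$\operatorname{qri}(\operatorname{gph}(F))=\{(x,y)\in X\times Y\mid x\in\operatorname{qri}(\operatorname{dom}(F)),\ y\in\operatorname{qri}(F(x))\}.$$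
   Context: For a set-valued mapping $F\colon X\rightrightarrows Y$: $\operatorname{dom}(F)=\{x\mid F(x)\neq\emptyset\}$, $\operatorname{gph}(F)=\{(x,y)\in X\times Y\mid y\in F(x)\}$. For a subset $\Omega$ of a topological vector space $Z$ (not necessarily convex), $\operatorname{cone}(\Omega)=\{\lambda w\mid\lambda\ge0,\ w\in\Omega\}$ and $\overline{\operatorname{cone}}(\Omega)$ is its closure. Define: quasi-interior $\operatorname{qi}(\Omega)=\{z\in\Omega\mid\overline{\operatorname{cone}}(\Omega-z)=Z\}$; intrinsic relative interior $\operatorname{iri}(\Omega)=\{z\in\Omega\mid\operatorname{cone}(\Omega-z)\text{ is a linear subspace of }Z\}$; quasi-relative interior $\operatorname{qri}(\Omega)=\{z\in\Omega\mid\overline{\operatorname{cone}}(\Omega-z)\text{ is a linear subspace of }Z\}$. $\Omega$ is quasi-regular if $\operatorname{qri}(\Omega)=\operatorname{iri}(\Omega)$. A nonempty set $\Omega\subset Z$ is quasi-nearly convex if there is a convex set $C\subset Z$ with $\operatorname{qri}(C)\neq\emptyset$ and $C\subset\Omega\subset\overline{C}$. The mapping $F$ is quasi-nearly convex if $\operatorname{gph}(F)$ is a quasi-nearly convex set in $X\times Y$. *)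

(* Defs.v *)
(* [tvsType R] is the type of locally convex topological vector spaces; it does
   not require the Hausdorff property. *)
From HB Require Import structures.
From mathcomp Require Import all_boot all_order all_algebra.
From mathcomp Require Import all_classical all_reals all_analysis.

Set Implicit Arguments.
Unset Strict Implicit.
Unset Printing Implicit Defensive.

Import Order.TTheory GRing.Theory Num.Theory.

Local Open Scope classical_set_scope.
Local Open Scope ring_scope.

Section Mappings.
Context {X Y : Type}.
Implicit Type F : X -> set Y.

Definition svdom F : set X := [set x | F x !=set0].

Definition gph F : set (X * Y) := [set p | F p.1 p.2].

End Mappings.

Section RelativeInteriors.
Context {R : realType} {Z : tvsType R}.
Implicit Types (Omega C : set Z) (z : Z).

Definition cone Omega : set Z :=
  [set l *: w | l in [set l : R | 0 <= l] & w in Omega].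

Definition closed_cone Omega : set Z := closure (cone Omega).

Definition subtract_point Omega z : set Z := [set w - z | w in Omega].

Definition linear_subspace Omega : Prop := GRing.submod_closed [in Omega].

Definition qi Omega : set Z :=
  [set z | Omega z /\ closed_cone (subtract_point Omega z) = setT].

Definition iri Omega : set Z :=
  [set z | Omega z /\ linear_subspace (cone (subtract_point Omega z))].

Definition qri Omega : set Z :=
  [set z | Omega z /\ linear_subspace (closed_cone (subtract_point Omega z))].

Definition quasi_regular Omega : Prop := qri Omega = iri Omega.

Definition quasi_nearly_convex Omega : Prop :=
  Omega !=set0 /\
  exists C : set Z,
    [/\ convex_set C, qri C !=set0, C `<=` Omega & Omega `<=` closure C].

End RelativeInteriors.

Definition quasi_nearly_convex_map {R : realType} {X Y : tvsType R}
    (F : X -> set Y) : Prop :=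
  quasi_nearly_convex (gph F).

(* Main.v *)
Require Import Defs.
From HB Require Import structures.
From mathcomp Require Import all_boot all_order all_algebra.
From mathcomp Require Import all_classical all_reals all_analysis.

(** Write p = (x, y) for a point of the graph, L for the cone generated by
gph F - p, and K for the closure of L.

Part (a) is linear algebra. The cone of dom F - x is the projection of L to X
[cone_svdomP], and the cone of F x - y is the slice of L over 0
[cone_valueP]: a nonzero multiple of (x' - x, y' - y) lies over 0 only if
x' = x. If L is a subspace, so are its projection and its slice. Hence p in
iri (gph F) gives x in iri (dom F) and y in iri (F x) [iri_gph];
quasi-regularity turns qri (gph F) into iri (gph F), and iri is always
contained in qri because the closure of a subspace is a subspace.

For part (b), a quasi-relative interior point of F x is a quasi-interior point
as soon as F x has some quasi-interior point [qri_subset_qi]. So K contains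
every vertical vector (0, v). Near convexity of the graph makes K stable under
addition, hence K is invariant under vertical translations; it is therefore the
full preimage N x Y of the closed cone N of dom F - x [closed_cone_gphE], and it
is a subspace when N is one.

The equality combines (a) with the same argument for (b), whose input on the
values of F is a nonempty quasi-interior. *)

Import Order.TTheory GRing.Theory Num.Theory.

Local Open Scope classical_set_scope.
Local Open Scope ring_scope.

(** * Closures and cones *)

Lemma closure_maps (S T : topologicalType) (f : S -> T) (A : set S)
    (B : set T) : continuous f -> (forall u, A u -> B (f u)) ->
  forall u, closure A u -> closure B (f u).
Proof.
move=> fc fAB u Au V /fc /Au [w [Aw Vw]].
by exists (f w); split => //; exact: fAB.
Qed.

(** The closure of A is the least closed set containing A. *)
Lemma closure_closure_sub (T : topologicalType) (A B : set T) :
  (forall u, A u -> closure B u) -> forall u, closure A u -> closure B u.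
Proof.
move=> AB u /(closureS AB).
by rewrite -(iffLR (closure_id _) (@closed_closure _ B)).
Qed.

Section Cones.
Context {R : realType} {Z : tvsType R}.
Implicit Types (A C Omega : set Z) (u v z : Z).

Lemma linear_subspaceP A :
  linear_subspace A <->
  A 0 /\ forall (a : R) u v, A u -> A v -> A (a *: u + v).
Proof.
split=> [[A0 Alin]|[A0 Alin]]; split.
- exact: set_mem A0.
- by move=> a u v /mem_set Au /mem_set Av; apply: set_mem; exact: Alin.
- exact: mem_set A0.
- by move=> a u v /set_mem Au /set_mem Av; apply: mem_set; exact: Alin.
Qed.

Lemma affine_continuous (a : R) v : continuous (fun u : Z => a *: u + v).
Proof.
move=> u; apply: (@continuous_comp _ _ _ (fun u => (a *: u, v))
  (fun p : Z * Z => p.1 + p.2)); last exact: add_continuous.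
apply: cvg_pair; last exact: cvg_cst.
apply: (@continuous_comp Z (R^o * Z)%type Z (fun x => (a, x))
  (fun p => p.1 *: p.2)); last exact: scale_continuous.
by apply: (@cvg_pair _ _ _ _ (nbhs (a : R^o))); [exact: cvg_cst|exact: cvg_id].
Qed.

(** Separate continuity suffices: the closure absorbs the first argument with
the second one fixed in A, and then the second one. *)
Lemma closure_lincomb A (a : R) :
  (forall u v, A u -> A v -> A (a *: u + v)) ->
  forall u v, closure A u -> closure A v -> closure A (a *: u + v).
Proof.
move=> Aa u v Au.
have {}Aa w : A w -> closure A (a *: u + w).
  move=> Aw; apply: (closure_maps _ _ (fun u => a *: u + w) A) => //.
    exact: affine_continuous.
  by move=> u' Au'; exact: Aa.
move=> Av; rewrite addrC -[v]scale1r.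
apply: (@closure_closure_sub _ [set 1 *: w + a *: u | w in A]).
  by move=> _ [w /Aa + <-]; rewrite scale1r addrC.
apply: (closure_maps _ _ (fun v => 1 *: v + a *: u) A) Av; last first.
  by move=> w Aw; exists w.
exact: affine_continuous.
Qed.

Lemma closure_linear_subspace A :
  linear_subspace A -> linear_subspace (closure A).
Proof.
move=> /linear_subspaceP[A0 Alin]; apply/linear_subspaceP; split.
  exact: subset_closure.
by move=> a; exact: closure_lincomb (Alin a).
Qed.

Lemma cone_subtract_pointP Omega z u :
  cone (subtract_point Omega z) u <->
  exists l w, [/\ 0 <= l :> R, Omega w & u = l *: (w - z)].
Proof.
split=> [[l l0 [_ [w Ow <-] <-]]|[l [w [l0 Ow ->]]]]; first by exists l, w.
by exists l => //; exists (w - z) => //; exists w.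
Qed.

Lemma iri_subset_qri Omega : iri Omega `<=` qri Omega.
Proof. by move=> z [Oz /closure_linear_subspace]. Qed.

(** If M, the closed cone of Omega - z, is a subspace, it contains every
difference of two points of Omega, so it contains Omega - z0 for any other z0.
When z0 is a quasi-interior point, this forces M to be the whole space. *)
Lemma qri_subset_qi Omega : qi Omega !=set0 -> qri Omega `<=` qi Omega.
Proof.
move=> [z0 [Oz0 z0T]] z [Oz /linear_subspaceP[M0 Mlin]].
split=> //; apply/seteqP; split=> // u _.
have: closed_cone (subtract_point Omega z0) u by rewrite z0T.
apply: closure_closure_sub => {}u /cone_subtract_pointP[l [w [_ Ow ->]]].
have shift w' : Omega w' -> closed_cone (subtract_point Omega z) (w' - z).
  move=> Ow'; apply: subset_closure; apply/cone_subtract_pointP.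
  by exists 1, w'; split => //; rewrite scale1r.
have -> : l *: (w - z0) = l *: (-1 *: (z0 - z) + (w - z)) + 0.
  by rewrite addr0 scaleN1r opprB [_ + (w - z)]addrC subrKA.
by apply: (Mlin l _ _ _ M0); apply: Mlin; exact: shift.
Qed.

Lemma convex_set_comb C (t : R) u v : convex_set C -> 0 <= t <= 1 ->
  C u -> C v -> C (t *: u + (1 - t) *: v).
Proof.
move=> Ccvx /andP[t0 t1] Cu Cv.
exact: set_mem (Ccvx u v (Itv01 t0 t1) (mem_set Cu) (mem_set Cv)).
Qed.

(** a (c - z) + b (d - z) is a + b times the vector from z to the barycentre of
c and d with weights a and b. *)
Lemma cone_convexD C z u v : convex_set C ->
  cone (subtract_point C z) u -> cone (subtract_point C z) v ->
  cone (subtract_point C z) (u + v).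
Proof.
move=> Ccvx /cone_subtract_pointP[a [c [a0 Cc ->]]].
move=> /cone_subtract_pointP[b [d [b0 Cd ->]]]; apply/cone_subtract_pointP.
have [ab0|ab0] := eqVneq (a + b) 0.
  have/andP[/eqP-> /eqP->] : (a == 0) && (b == 0) by rewrite -paddr_eq0// ab0.
  by exists 0, c; split => //; rewrite !scale0r addr0.
pose t := a / (a + b).
have ta : (a + b) * t = a by rewrite mulrC divfK.
have t01 : 0 <= t <= 1.
  rewrite divr_ge0 ?addr_ge0//= ler_pdivrMr ?lt0r ?ab0 ?addr_ge0//.
  by rewrite mul1r lerDl.
exists (a + b), (t *: c + (1 - t) *: d); split; first exact: addr_ge0.
  exact: convex_set_comb.
rewrite !scalerBr scalerDr !scalerA mulrBr mulr1 ta [a + b - a]addrC addKr.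
by rewrite [(a + b) *: z]scalerDl opprD addrACA.
Qed.

(** The map w |-> l (w - z) is continuous, so it sends closure C into the closed
cone of C - z. Through this equality a quasi-nearly convex set is replaced by
the convex set that it approximates. *)
Lemma closed_cone_closure_sub C Omega z :
  C `<=` Omega -> Omega `<=` closure C ->
  closed_cone (subtract_point Omega z) = closed_cone (subtract_point C z).
Proof.
move=> CO OC; apply/seteqP; split => u.
  apply: closure_closure_sub => {}u /cone_subtract_pointP[l [w [l0 /OC Cw ->]]].
  rewrite scalerBr.
  apply: (closure_maps _ _ (fun w => l *: w + - (l *: z)) C) => //.
    exact: affine_continuous.
  move=> c Cc; apply/cone_subtract_pointP; exists l, c.
  by rewrite scalerBr.
apply: closureS => {}u /cone_subtract_pointP[l [w [l0 /CO Ow ->]]].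
by apply/cone_subtract_pointP; exists l, w.
Qed.

Lemma closed_cone_quasi_nearly_convexD Omega z u v :
  quasi_nearly_convex Omega ->
  closed_cone (subtract_point Omega z) u ->
  closed_cone (subtract_point Omega z) v ->
  closed_cone (subtract_point Omega z) (u + v).
Proof.
move=> [_ [C [Ccvx _ CO OC]]]; rewrite (closed_cone_closure_sub _ _ _ CO OC).
rewrite -[u in u + _]scale1r; apply: closure_lincomb => {}u {}v Cu Cv.
by rewrite scale1r; exact: cone_convexD.
Qed.

End Cones.

(** * Graphs of set-valued mappings *)

Section Graphs.
Context {R : realType} {X Y : tvsType R}.
Variables (F : X -> set Y) (x : X) (y : Y).

Local Notation graph := (gph F : set (X * Y)%type).
Local Notation L := (cone (subtract_point graph (x, y))).
Local Notation K := (closed_cone (subtract_point graph (x, y))).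

Lemma cone_svdomP u :
  cone (subtract_point (svdom F) x) u <-> exists v, L (u, v).
Proof.
split=> [/cone_subtract_pointP[l [x' [l0 [y' Fy'] ->]]]|[v]].
  exists (l *: (y' - y)); apply/cone_subtract_pointP.
  by exists l, (x', y').
move=> /cone_subtract_pointP[l [[x' y'] [l0 Fy' [-> _]]]].
by apply/cone_subtract_pointP; exists l, x'; split => //; exists y'.
Qed.

(** A multiple l (x' - x, y' - y) with first component 0 has l = 0 or x' = x. *)
Lemma cone_valueP v : F x y ->
  cone (subtract_point (F x) y) v <-> L (0, v).
Proof.
move=> Fxy; split=> /cone_subtract_pointP.
  move=> [l [w [l0 Fw ->]]]; apply/cone_subtract_pointP.
  exists l, (x, w); split => //.
  by congr pair; rewrite /= subrr scaler0.
move=> [l [[x' y'] [l0 Fy' [/esym/eqP l0x ->]]]].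
apply/cone_subtract_pointP; move: l0x; rewrite scaler_eq0 => /orP[/eqP->|].
  by exists 0, y; rewrite !scale0r.
by rewrite subr_eq0 => /eqP x'x; exists l, y'; split => //; rewrite -x'x.
Qed.

Lemma iri_gph : iri graph (x, y) -> iri (svdom F) x /\ iri (F x) y.
Proof.
move=> [Fxy /linear_subspaceP[L0 Llin]]; split; split.
- by exists y.
- apply/linear_subspaceP; split; first by apply/cone_svdomP; exists 0.
  move=> a u u' /cone_svdomP[v Luv] /cone_svdomP[v' Luv'].
  by apply/cone_svdomP; exists (a *: v + v'); exact: Llin a _ _ Luv Luv'.
- by [].
- apply/linear_subspaceP; split; first exact/cone_valueP.
  move=> a v v' /(cone_valueP _ Fxy) Lv /(cone_valueP _ Fxy) Lv'.
  apply/cone_valueP => //; have := Llin a _ _ Lv Lv'.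
  by congr (L _); congr pair; rewrite /= scaler0 addr0.
Qed.

(** K contains the vertical directions and is stable under addition, so it is
the preimage, under the projection to X, of its slice at height 0. That slice
is closed and contains the cone of dom F - x, hence also its closure. *)
Lemma closed_cone_gphE : quasi_nearly_convex graph ->
  qi (F x) y ->
  K = [set p | closed_cone (subtract_point (svdom F) x) p.1].
Proof.
move=> Fqnc [Fxy FxT].
have vert v : K (0, v).
  have : closed_cone (subtract_point (F x) y) v by rewrite FxT.
  apply: (closure_maps _ _ (fun v => (0, v))).
    by move=> w; apply: cvg_pair; [exact: cvg_cst|exact: cvg_id].
  by move=> w /(cone_valueP _ Fxy).
apply/seteqP; split=> [p|[u v] /= Nu].
  apply: (closure_maps _ _ fst); first by move=> q; exact: cvg_fst.
  by move=> [u v] Luv; apply/cone_svdomP; exists v.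
have -> : (u, v) = (u, 0) + (0, v) by congr pair; rewrite /= ?addr0 ?add0r.
apply: (closed_cone_quasi_nearly_convexD _ _ _ _ Fqnc _ (vert _)).
apply: (@closure_closure_sub _
    [set (w, 0) | w in cone (subtract_point (svdom F) x)]).
  move=> _ [w /cone_svdomP[v' Lwv'] <-].
  (* (w, v') is in L; the vertical vector (0, - v') brings it down to (w, 0). *)
  have -> : (w, 0) = (w, v') + (0, - v').
    by congr pair; rewrite /= ?addr0 ?subrr.
  apply: (closed_cone_quasi_nearly_convexD _ _ _ _ Fqnc _ (vert _)).
  exact: subset_closure.
apply: (closure_maps _ _ (fun w => (w, 0))) Nu; last by move=> w ?; exists w.
by move=> w; apply: cvg_pair; [exact: cvg_id|exact: cvg_cst].
Qed.

Lemma qri_gph : quasi_nearly_convex graph ->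
  qi (F x) !=set0 -> qri (svdom F) x -> qri (F x) y ->
  qri graph (x, y).
Proof.
move=> Fqnc /qri_subset_qi qiF [_ /linear_subspaceP[N0 Nlin]] /qiF yqi.
split; first exact: yqi.1.
rewrite closed_cone_gphE//.
by apply/linear_subspaceP; split => //= a p q; exact: Nlin.
Qed.

End Graphs.

Theorem theorem6p2 (R : realType) (X Y : tvsType R) (F : X -> set Y)
    (hF : quasi_nearly_convex_map F) :
  [/\ quasi_regular (gph F) ->
        qri (gph F) `<=`
          [set p : X * Y | qri (svdom F) p.1 /\ qri (F p.1) p.2],
      (forall x : X, svdom F x ->
         quasi_nearly_convex (F x) /\ qi (F x) !=set0) ->
        [set p : X * Y | qri (svdom F) p.1 /\ qri (F p.1) p.2]
          `<=` qri (gph F) &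
      quasi_regular (gph F) ->
        (forall x : X, svdom F x -> qi (F x) !=set0) ->
        qri (gph F) =
          [set p : X * Y | qri (svdom F) p.1 /\ qri (F p.1) p.2]].
Proof.
have projection : quasi_regular (gph F) -> qri (gph F) `<=`
    [set p : X * Y | qri (svdom F) p.1 /\ qri (F p.1) p.2].
  by move=> -> [x y] /iri_gph[? ?]; split; exact: iri_subset_qri.
have lift : (forall x, svdom F x -> qi (F x) !=set0) ->
    [set p : X * Y | qri (svdom F) p.1 /\ qri (F p.1) p.2] `<=` qri (gph F).
  by move=> qiF [x y] [/= xdom yF]; apply: qri_gph => //; exact: qiF xdom.1.
split=> // [qiF|Fqr qiF]; first by apply: lift => x /qiF[].
by apply/seteqP; split; [exact: projection|exact: lift].
Qed.
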